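(* Let $f:\mathbb{R}^2\to\mathbb{R}$ be a $C^2$-smooth norm-coercive function. If $C(f)$ and $\mathbb{R}^2\setminus\mathrm{Hess}^+(f)$ are bounded, then the level set $f^{-1}(c)$ is compact, connected, regular and convex for all sufficiently large $c$ (i.e. there is $c_0\in\mathbb{R}$ such that this holds for every $c>c_0$).
   Context: For a $C^2$-smooth function $f:\mathbb{R}^2\to\mathbb{R}$, $H_x(f)$ denotes the Hessian matrix of $f$ at $x$, $\mathrm{Hess}^+(f)=\{x\in\mathbb{R}^2 : H_x(f)\text{ is positive definite}\}$, and $C(f)=\{x\in\mathbb{R}^2:\nabla f(x)=0\}$ is the critical set. Norm-coercive means $f(x)\to+\infty$ as $\|x\|\to\infty$. A level set $f^{-1}(c)$ is regular if it contains no critical point of $f$. A level set $f^{-1}(c)$ is said to be convex if it bounds a convex sublevel set, i.e. if the sublevel set $f^{-1}((-\infty,c])$ is a convex subset of $\mathbb{R}^2$. *)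

(* Defs.v *)
From HB Require Import structures.
From mathcomp Require Import all_boot all_order all_algebra.
From mathcomp Require Import all_classical all_reals all_analysis.

Set Implicit Arguments.
Unset Strict Implicit.
Unset Printing Implicit Defensive.

Import Order.TTheory GRing.Theory Num.Theory.
Import numFieldNormedType.Exports.

Local Open Scope classical_set_scope.
Local Open Scope ring_scope.

Definition partial {R : realType} {n : nat} (i : 'I_n) (f : 'rV[R]_n -> R) :
    'rV[R]_n -> R :=
  'D_(delta_mx 0 i) f.

(* C^k smoothness: C^0 is continuity; f is C^(k+1) when it is (Frechet)
   differentiable everywhere and the components of its derivative are C^k. *)
Fixpoint smooth {R : realType} {n : nat} (k : nat) (f : 'rV[R]_n -> R) : Prop :=
  if k is k'.+1 then
    (forall x, differentiable f x) /\ (forall i, smooth k' (partial i f))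
  else continuous f.

Definition gradient {R : realType} {n : nat} (f : 'rV[R]_n -> R)
    (x : 'rV[R]_n) : 'rV[R]_n :=
  \row_i partial i f x.

Definition hessian {R : realType} {n : nat} (f : 'rV[R]_n -> R)
    (x : 'rV[R]_n) : 'M[R]_n :=
  \matrix_(i, j) partial i (partial j f) x.

Definition posdefmx {R : realType} {n : nat} (A : 'M[R]_n) : Prop :=
  A^T = A /\ forall v : 'rV[R]_n, v != 0 -> 0 < (v *m A *m v^T) 0 0.

Definition hess_pos {R : realType} {n : nat} (f : 'rV[R]_n -> R) :
    set 'rV[R]_n :=
  [set x | posdefmx (hessian f x)].

Definition critical_set {R : realType} {n : nat} (f : 'rV[R]_n -> R) :
    set 'rV[R]_n :=
  [set x | gradient f x = 0].

(* The library norm on 'rV[R]_n is the sup norm; all norms on R^n being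
   equivalent, this choice affects neither coercivity nor boundedness. *)
Definition norm_coercive {R : realType} {n : nat} (f : 'rV[R]_n -> R) : Prop :=
  forall A : R, exists M : R, forall x : 'rV[R]_n, M <= `|x| -> A <= f x.

Definition level_set {R : realType} {n : nat} (f : 'rV[R]_n -> R) (c : R) :
    set 'rV[R]_n :=
  f @^-1` [set c].

Definition sublevel_set {R : realType} {n : nat} (f : 'rV[R]_n -> R) (c : R) :
    set 'rV[R]_n :=
  f @^-1` [set y | y <= c].

Definition regular_level {R : realType} {n : nat} (f : 'rV[R]_n -> R)
    (c : R) : Prop :=
  level_set f c `&` critical_set f = set0.

(* Convexity of the level set f^-1(c) means convexity of the sublevel set it
   bounds, not of f^-1(c) itself. *)
Definition convex_level {R : realType} {n : nat} (f : 'rV[R]_n -> R)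
    (c : R) : Prop :=
  convex_set (sublevel_set f c : set (convex_lmodType 'rV[R]_n)).

(* Main.v *)
(* Fix a ball B containing the critical points and the points where the Hessian
   is not positive definite, and let c exceed the maximum of f on B.  On a
   segment with endpoints in {f <= c}, a maximum of f with value at least c in
   the interior would be attained outside B, where the second derivative along
   the segment is positive: impossible.  So f < c in the interior of the
   segment, which gives convexity of {f <= c} at once.  It also implies that
   every ray from the origin crosses f^-1(c) exactly once, at a distance
   depending continuously on the direction; hence f^-1(c) is a union of four
   successively meeting continuous images of R, one per coordinate
   half-plane. *)
Require Import Defs.
From mathcomp Require Import all_boot all_order all_algebra.
From mathcomp Require Import all_classical all_reals all_analysis.
Import Order.TTheory GRing.Theory Num.Theory.
Import numFieldNormedType.Exports.
Local Open Scope classical_set_scope.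
Local Open Scope ring_scope.

Set Implicit Arguments.
Unset Strict Implicit.

(** * Directional derivatives and the Hessian form *)

Lemma derive_partial (R : realType) (n : nat) (h : 'rV[R]_n -> R)
    (x v : 'rV[R]_n) : differentiable h x ->
  'D_v h x = \sum_i v 0 i * partial i h x.
Proof.
move=> dh; rewrite deriveE// {1}(row_sum_delta v) linear_sum.
by apply: eq_bigr => i _; rewrite linearZ /partial deriveE.
Qed.

Lemma derive_sum_partial (R : realType) (n : nat) (h : 'rV[R]_n -> R)
    (v : 'rV[R]_n) : (forall x, differentiable h x) ->
  'D_v h = \sum_i v 0 i *: partial i h.
Proof.
by move=> dh; apply/funext => x; rewrite derive_partial// fct_sumE.
Qed.

Lemma is_derive_line (R : realType) (V : normedModType R) (h : V -> R)
    (x v : V) (t : R) : differentiable h (x + t *: v) ->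
  is_derive t 1 (fun s => h (x + s *: v)) ('D_v h (x + t *: v)).
Proof.
move=> dh; have /derivableP[dv] := diff_derivable (v := v) dh.
(* Both derivatives are limits of literally the same difference quotient. *)
have E : (fun s : R => s^-1 *: (((fun r : R => h (x + r *: v)) \o shift t)
    (s *: (1 : R)) - h (x + t *: v))) =
    (fun s => s^-1 *: ((h \o shift (x + t *: v)) (s *: v) - h (x + t *: v))).
  apply/funext => s /=; congr (_ *: (h _ - _)).
  by rewrite [s *: 1]mulr1 scalerDl addrCA addrA.
by split; rewrite /derivable /derive E.
Qed.

Lemma derive_derive_hessian (R : realType) (n : nat) (f : 'rV[R]_n -> R)
    (x v : 'rV[R]_n) : smooth 2 f ->
  'D_v ('D_v f) x = (v *m hessian f x *m v^T) 0 0.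
Proof.
move=> [df sf]; rewrite derive_sum_partial//.
have dp j : differentiable (partial j f) x by have [+ _] := sf j; exact.
have dv j : derivable (partial j f) x v by exact: diff_derivable.
rewrite derive_sum => [|i]; last exact: derivableZ.
rewrite mxE; apply: eq_bigr => j _.
rewrite deriveZ// derive_partial// !mxE mulrC; congr *%R.
by apply: eq_bigr => i _; rewrite mxE.
Qed.

(** At an interior maximum [dg m = 0]; since [k > 0], [dg] is then positive just to the right of
    [m], and the mean value theorem makes [g] exceed [g m] there. *)
Lemma not_local_max (R : realType) (g dg : R -> R) (a b m k : R) :
  (forall t : R, is_derive t 1 g (dg t)) -> is_derive m 1 dg k -> 0 < k ->
  m \in `]a, b[ -> exists2 t, t \in `]a, b[ & g m < g t.
Proof.
move=> gd dgd k0 mab; apply: contrapT => /forall2NP H.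
have gm t : t \in `]a, b[ -> g t <= g m.
  by move=> tab; have [//|] := H t; rewrite leNgt => /negP.
move: (mab); rewrite in_itv/= => /andP[am mb].
have dgm : dg m = 0.
  have ab : a <= b by apply/ltW/(lt_trans am).
  have dm := derive1_at_max ab
    (fun t _ => ex_derive (is_derive := gd t)) mab gm.
  by rewrite -[LHS](@derive_val _ _ _ _ _ _ _ (gd m)) derive_val.
have dgd' := @ex_derive _ _ _ _ _ _ _ dgd.
have := @derive_val _ _ _ _ _ _ _ dgd.
(* [derivable] unfolds to convergence of the difference quotient to its own limit, which [E]
   identifies with [k]. *)
rewrite /derive => E; move: dgd'; rewrite /derivable.
rewrite E.
move=> /cvg_dnbhs_at_right /cvgr_gt /(_ 0 k0) [e /= e0 He].
pose d := Num.min (e / 2) ((b - m) / 2).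
have bm : 0 < b - m by rewrite subr_gt0.
have d0 : 0 < d by rewrite lt_min !divr_gt0.
have de : d < e by rewrite gt_min ltr_pdivrMr// ltr_pMr// ltr1n.
have db : m + d < b.
  by rewrite -ltrBrDl gt_min [X in _ || X]ltr_pdivrMr// ltr_pMr// ltr1n orbT.
have [||t tmd gE] := @MVT R g dg m (m + d) _ (fun t _ => gd t).
- by rewrite ltrDl.
- apply: derivable_within_continuous => t _.
  exact: (ex_derive (is_derive := gd t)).
have : g (m + d) <= g m.
  by apply: gm; rewrite in_itv/= db andbT (lt_trans am)// ltrDl.
rewrite -subr_le0 gE addrAC subrr add0r leNgt => /negP; apply.
rewrite mulr_gt0//.
move: tmd; rewrite in_itv/= => /andP[mt tmd].
have tm0 : 0 < t - m by rewrite subr_gt0.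
have := He (t - m); rewrite /= sub0r normrN gtr0_norm//.
rewrite dgm subr0 [(t - m) *: 1]mulr1 subrK.
move=> /(_ _ tm0); rewrite [_ *: _]/(_ * _) pmulr_rgt0 ?invr_gt0//; apply.
by rewrite ltrBlDl (lt_trans tmd)// ltrD2l.
Qed.

(** The inequality is strict even when an endpoint has value [c]; uniqueness of the crossing on each
    ray rests on this. *)
Lemma strictly_quasiconvex (R : realType) (n : nat) (f : 'rV[R]_n -> R) (c : R)
    (x v : 'rV[R]_n) (s : R) : smooth 2 f ->
  (forall z, c <= f z -> hess_pos f z) -> v != 0 ->
  f x <= c -> f (x + v) <= c -> 0 < s < 1 -> f (x + s *: v) < c.
Proof.
move=> f2 fc v0 fx fy s01; rewrite ltNge; apply/negP => cs.
have [df sf] := f2.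
pose g := fun t : R => f (x + t *: v).
have gd (t : R) : is_derive t 1 g ('D_v f (x + t *: v)).
  exact: is_derive_line.
have no_max (m : R) : c <= g m -> m \in `]0, 1[ ->
    exists2 t, t \in `]0, 1[ & g m < g t.
  move=> cm m01.
  have dDf : differentiable ('D_v f) (x + m *: v).
    rewrite derive_sum_partial//; apply: differentiable_sum => i.
    apply: differentiableZ.
    by have [+ _] := sf i; exact.
  have [_ H] := fc _ cm.
  apply: (not_local_max gd (is_derive_line dDf) _ m01).
  by rewrite derive_derive_hessian//; exact: H.
have [m m01 gm] : exists2 m, m \in `[0, 1] &
    forall t, t \in `[0, 1] -> g t <= g m.
  apply: EVT_max => //; apply: derivable_within_continuous => t _.
  exact: (ex_derive (is_derive := gd t)).
have gmax (t : R) : t \in `]0, 1[ -> g t <= g m.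
  by move=> t01; apply: gm; apply: subset_itv_oo_cc.
have s01' : s \in `]0, 1[ by rewrite in_itv.
(* In that case [s] is itself an interior maximum with value at least [c]. This settles a maximum at
   an endpoint, where [g m <= c <= g s]. *)
have csm : g m <= g s -> False.
  move=> ms; have [//|t t01] := no_max s cs.
  by rewrite ltNge (le_trans (gmax _ t01)).
have gsm := gmax _ s01'.
have [m01'|] := boolP (m \in `]0, 1[).
  have [|t t01] := no_max m _ m01'; first exact: le_trans gsm.
  by rewrite ltNge gmax.
have gle : g m <= c -> False by move=> mc; apply: csm; exact: le_trans cs.
move: m01; rewrite !in_itv/= => /andP[m0 m1] /negP; apply.
have [mE|m0'] := eqVneq m 0; first by case: gle; rewrite mE /g scale0r addr0.
have [mE|m1'] := eqVneq m 1; first by case: gle; rewrite mE /g scale1r.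
by rewrite !lt_neqAle m0 m1 m1' eq_sym m0'.
Qed.

Lemma smooth2_continuous (R : realType) (n : nat) (f : 'rV[R]_n -> R) :
  smooth 2 f -> continuous f.
Proof. by move=> [df _] x; exact: differentiable_continuous. Qed.

(** * Rays from the origin and the radial function *)

Lemma ray_sublevel (R : realType) (n : nat) (f : 'rV[R]_n -> R) (c : R)
    (w : 'rV[R]_n) (s t : R) : smooth 2 f ->
  (forall z, c <= f z -> hess_pos f z) -> f 0 < c -> w != 0 ->
  0 < s < t -> f (t *: w) <= c -> f (s *: w) < c.
Proof.
move=> f2 fc f0c w0 /andP[s0 st] ftc; have t0 := lt_trans s0 st.
(* View [s *: w] as the point of parameter [s / t] on the segment from [0] to [t *: w]. *)
rewrite -[s](divfK (lt0r_neq0 t0)) -scalerA -[_ *: _]add0r.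
apply: strictly_quasiconvex => //.
- by rewrite scaler_eq0 negb_or w0 lt0r_neq0.
- exact: ltW.
- by rewrite add0r.
- by rewrite divr_gt0// ltr_pdivrMr// mul1r.
Qed.

Lemma ray_superlevel (R : realType) (n : nat) (f : 'rV[R]_n -> R) (c : R)
    (w : 'rV[R]_n) (s t : R) : smooth 2 f ->
  (forall z, c <= f z -> hess_pos f z) -> f 0 < c -> w != 0 ->
  0 < s < t -> c <= f (s *: w) -> c < f (t *: w).
Proof.
move=> f2 fc f0c w0 st; rewrite !ltNge; apply: contraTN.
by move=> /(ray_sublevel f2 fc f0c w0 st); rewrite -ltNge.
Qed.

Lemma ray_inj (R : realType) (n : nat) (f : 'rV[R]_n -> R) (c : R)
    (w : 'rV[R]_n) (s t : R) : smooth 2 f ->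
  (forall z, c <= f z -> hess_pos f z) -> f 0 < c ->
  0 < s -> 0 < t -> f (s *: w) = c -> f (t *: w) = c -> s = t.
Proof.
move=> f2 fc f0c s0 t0 fs ft.
have w0 : w != 0.
  by apply/eqP => w0; move: f0c; rewrite -fs w0 scaler0 ltxx.
have [st|ts|//] := ltgtP s t.
- have := ray_superlevel (s := s) (t := t) f2 fc f0c w0.
  by rewrite s0 st fs ft ltxx => /(_ isT (lexx _)).
- have := ray_superlevel (s := t) (t := s) f2 fc f0c w0.
  by rewrite t0 ts fs ft ltxx => /(_ isT (lexx _)).
Qed.

(** The distance to the level set along [w], in units of [w], which is not normalized. The default 0
    is taken when there is no crossing. *)
Definition radius (R : realType) (n : nat) (f : 'rV[R]_n -> R) (c : R)
    (w : 'rV[R]_n) : R :=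
  xget 0 [set t | 0 < t /\ f (t *: w) = c].

Lemma radiusP (R : realType) (n : nat) (f : 'rV[R]_n -> R) (c : R)
    (w : 'rV[R]_n) : continuous f -> norm_coercive f -> f 0 < c -> w != 0 ->
  0 < radius f c w /\ f (radius f c w *: w) = c.
Proof.
move=> fcont fcoer f0c w0.
have [M fM] := fcoer c.
have nw0 : 0 < `|w| by rewrite normr_gt0.
(* This makes the norm of [T *: w] equal to [|M|], which is at least [M] whatever its sign. *)
pose T := `|M| / `|w|.
have T0 : 0 <= T by rewrite divr_ge0.
have cT : c <= f (T *: w).
  by apply: fM; rewrite normrZ ger0_norm// divfK ?gt_eqF// ler_norm.
have [||t] := @IVT R (fun t => f (t *: w)) 0 T c T0.
- apply: continuous_subspaceT => t.
  apply: (@continuous_comp _ _ _ (fun t : R => t *: w) f); last exact: fcont.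
  exact: scalel_continuous.
- by rewrite scale0r ge_min le_max (ltW f0c) cT orbT.
rewrite in_itv/= => /andP[t0 _] ft.
apply: (@xgetPex _ 0 [set t | 0 < t /\ f (t *: w) = c]).
exists t; split=> //.
rewrite lt_neqAle t0 andbT eq_sym; apply/eqP => tE.
by move: ft f0c; rewrite tE scale0r => ->; rewrite ltxx.
Qed.

(** On the ray through [w], [f] is below [c] just before the crossing and above it just after. For
    two fixed factors this persists for [z] near [w], and the ray lemmas trap the crossing on the
    ray through [z] between them. *)
Lemma radius_continuous (R : realType) (n : nat) (f : 'rV[R]_n -> R) (c : R)
    (w : 'rV[R]_n) : smooth 2 f -> (forall z, c <= f z -> hess_pos f z) ->
  norm_coercive f -> f 0 < c -> w != 0 ->
  {for w, continuous (radius f c)}.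
Proof.
move=> f2 fc fcoer f0c w0; have fcont := smooth2_continuous f2.
have [t0 ft] := radiusP fcont fcoer f0c w0.
set t := radius f c w in t0 ft.
have sc (s : R) : f (s *: z) @[z --> w] --> f (s *: w).
  apply: (@continuous_cvg _ _ _ (nbhs w) _ (fun z : 'rV[R]_n => s *: z) f);
    first exact: fcont.
  exact: scaler_continuous.
apply/(@cvgrPdist_lt _ _ _ (nbhs w)) => e e0; rewrite -/t.
(* The bound [t / 2] keeps [t - d] positive, as the ray lemmas require. *)
pose d := Num.min (e / 2) (t / 2).
have d0 : 0 < d by rewrite lt_min !divr_gt0.
have de : d < e by rewrite gt_min ltr_pdivrMr// ltr_pMr// ltr1n.
have dt : d < t.
  by rewrite gt_min [X in _ || X]ltr_pdivrMr// ltr_pMr// ltr1n orbT.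
have td0 : 0 < t - d by rewrite subr_gt0.
have lo : f ((t - d) *: w) < c.
  apply: (ray_sublevel (t := t)) => //; last by rewrite ft.
  by rewrite td0 ltrBlDr ltrDl.
have hi : c < f ((t + d) *: w).
  apply: (ray_superlevel (s := t)) => //; last by rewrite ft.
  by rewrite t0 ltrDl.
near=> z.
have loz : f ((t - d) *: z) < c by near: z; exact: cvgr_lt lo.
have hiz : c < f ((t + d) *: z) by near: z; exact: cvgr_gt hi.
have z0 : z != 0.
  by apply: contraTneq hiz => ->; rewrite scaler0 -leNgt ltW.
have [r0 fr] := radiusP fcont fcoer f0c z0.
set r := radius f c z in r0 fr *.
apply: lt_trans de; rewrite distrC ltr_distl; apply/andP; split.
- rewrite ltNge le_eqVlt; apply/negP => /predU1P[rE|rt].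
    by move: loz; rewrite -rE fr ltxx.
  have := ray_superlevel (s := r) (t := t - d) f2 fc f0c z0.
  by rewrite r0 rt fr lexx ltNge (ltW loz) => /(_ isT isT).
- rewrite ltNge le_eqVlt; apply/negP => /predU1P[rE|tr].
    by move: hiz; rewrite rE fr ltxx.
  have := ray_sublevel (s := t + d) (t := r) f2 fc f0c z0.
  by rewrite addr_gt0// tr fr lexx ltNge (ltW hiz) => /(_ isT isT).
Unshelve. all: by end_near. Qed.

(** * Connectedness by radial projection of lines *)

Definition level_arc (R : realType) (n : nat) (f : 'rV[R]_n -> R) (c : R)
    (u v : 'rV[R]_n) : set 'rV[R]_n :=
  range (fun s : R => radius f c (u + s *: v) *: (u + s *: v)).

Lemma connected_level_arc (R : realType) (n : nat) (f : 'rV[R]_n -> R) (c : R)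
    (u v : 'rV[R]_n) : smooth 2 f -> (forall z, c <= f z -> hess_pos f z) ->
  norm_coercive f -> f 0 < c -> (forall s : R, u + s *: v != 0) ->
  connected (level_arc f c u v).
Proof.
move=> f2 fc fcoer f0c uv0; apply: connected_continuous_connected.
  by apply/connected_intervalP => x y _ _ z _.
apply: continuous_subspaceT => s.
have line : u + r *: v @[r --> s] --> u + s *: v.
  by apply: cvgD; [exact: cvg_cst | exact: scalel_continuous].
apply: cvgZ => //.
apply: (@continuous_cvg _ _ _ (nbhs s) _ (fun r : R => u + r *: v)) line.
exact: radius_continuous.
Qed.

Lemma sub_level_arc (R : realType) (n : nat) (f : 'rV[R]_n -> R) (c : R)
    (u v : 'rV[R]_n) : smooth 2 f -> norm_coercive f -> f 0 < c ->
  (forall s : R, u + s *: v != 0) -> level_arc f c u v `<=` level_set f c.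
Proof.
move=> f2 fcoer f0c uv0 _ [s _ <-].
by have [] := radiusP (smooth2_continuous f2) fcoer f0c (uv0 s).
Qed.

Lemma mem_level_arc (R : realType) (n : nat) (f : 'rV[R]_n -> R) (c : R)
    (u v : 'rV[R]_n) (a b : R) :
  smooth 2 f -> (forall z, c <= f z -> hess_pos f z) ->
  norm_coercive f -> f 0 < c -> (forall s : R, u + s *: v != 0) ->
  0 < a -> f (a *: u + b *: v) = c ->
  level_arc f c u v (a *: u + b *: v).
Proof.
move=> f2 fc fcoer f0c uv0 a0.
(* As [a > 0], the point lies on the ray through the line point of parameter [b / a], and uniqueness
   of the crossing forces [a] to be the radius. *)
have -> : a *: u + b *: v = a *: (u + (b / a) *: v).
  by rewrite scalerDr scalerA mulrCA divff ?mulr1// gt_eqF.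
move=> fa; exists (b / a) => //.
have [r0 fr] := radiusP (smooth2_continuous f2) fcoer f0c
  (uv0 (b / a)).
by rewrite (ray_inj f2 fc f0c r0 a0 fr fa).
Qed.

Lemma level_arc_meet (R : realType) (n : nat) (f : 'rV[R]_n -> R) (c : R)
    (u v u' v' : 'rV[R]_n) (s s' : R) : u + s *: v = u' + s' *: v' ->
  level_arc f c u v `&` level_arc f c u' v' !=set0.
Proof.
move=> E; exists (radius f c (u + s *: v) *: (u + s *: v)).
by split; [exists s | exists s'; rewrite // E].
Qed.

Lemma connected_level_set2 (R : realType) (f : 'rV[R]_2 -> R) (c : R) :
  smooth 2 f -> (forall z, c <= f z -> hess_pos f z) ->
  norm_coercive f -> f 0 < c -> connected (level_set f c).
Proof.
move=> f2 fc fcoer f0c.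
pose e0 : 'rV[R]_2 := delta_mx 0 0; pose e1 : 'rV[R]_2 := delta_mx 0 1.
have n01 (s : R) : e0 + s *: e1 != 0.
  apply/eqP => /matrixP/(_ 0 0); rewrite !mxE/= mulr0 addr0.
  by apply/eqP; rewrite oner_eq0.
have n10 (s : R) : e1 + s *: e0 != 0.
  apply/eqP => /matrixP/(_ 0 1); rewrite !mxE/= mulr0 addr0.
  by apply/eqP; rewrite oner_eq0.
have nN01 (s : R) : - e0 + s *: e1 != 0.
  by rewrite -oppr_eq0 opprD opprK -scaleNr.
have nN10 (s : R) : - e1 + s *: e0 != 0.
  by rewrite -oppr_eq0 opprD opprK -scaleNr.
pose arc := level_arc f c.
(* In order, the arcs lie over [x 0 0 > 0], [x 0 1 > 0], [x 0 0 < 0] and [x 0 1 < 0]. Only the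
   origin is left out, and [f 0 < c] there. *)
have -> : level_set f c =
    arc e0 e1 `|` arc e1 e0 `|` arc (- e0) e1 `|` arc (- e1) e0.
  apply/seteqP; split => [x fx|x].
    have xE : x = x 0 0 *: e0 + x 0 1 *: e1.
      rewrite {1}(row_sum_delta x) !big_ord_recl big_ord0 addr0.
      by congr (_ + x _ _ *: delta_mx _ _); exact/val_inj.
    have [x0|x0|x0] := ltgtP 0 (x 0 0).
    - by left; left; left; rewrite xE; apply: mem_level_arc; rewrite -?xE.
    - left; right.
      have xE' : x = (- x 0 0) *: (- e0) + x 0 1 *: e1.
        by rewrite scalerN scaleNr opprK.
      by rewrite xE'; apply: mem_level_arc; rewrite -?xE' ?oppr_gt0.
    have [x1|x1|x1] := ltgtP 0 (x 0 1).
    - left; left; right.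
      have xE' : x = x 0 1 *: e1 + x 0 0 *: e0 by rewrite addrC.
      by rewrite xE'; apply: mem_level_arc; rewrite -?xE'.
    - right.
      have xE' : x = (- x 0 1) *: (- e1) + x 0 0 *: e0.
        by rewrite scalerN scaleNr opprK addrC.
      by rewrite xE'; apply: mem_level_arc; rewrite -?xE' ?oppr_gt0.
    move: fx; rewrite /level_set/= xE -x0 -x1 !scale0r addr0 => fx.
    by move: f0c; rewrite fx ltxx.
  by move=> [[[|]|]|]; exact: sub_level_arc.
have C := connected_level_arc f2 fc fcoer f0c.
(* Successive arcs meet on a diagonal: parameters 1 or -1 give both lines the same point, here
   [e1 - e0]. *)
have meet10 : arc e1 e0 `&` arc (- e0) e1 !=set0.
  apply: (level_arc_meet f c (s := -1) (s' := 1)).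
  by rewrite scaleN1r scale1r addrC.
have meetN01 : arc (- e0) e1 `&` arc (- e1) e0 !=set0.
  by apply: (level_arc_meet f c (s := -1) (s' := -1)); rewrite !scaleN1r addrC.
apply: connectedU; last exact: C.
  by have [q [q1 q2]] := meetN01; exists q; split=> //; right.
apply: connectedU; last exact: C.
  by have [p [p1 p2]] := meet10; exists p; split=> //; right.
apply: connectedU; [|exact: C..].
by apply: (level_arc_meet f c (s := 1) (s' := 1)); rewrite !scale1r addrC.
Qed.

(** * Convexity, compactness and conclusion *)

Lemma convex_level_of_hess_pos (R : realType) (n : nat) (f : 'rV[R]_n -> R)
    (c : R) : smooth 2 f -> (forall z, c <= f z -> hess_pos f z) ->
  convex_level f c.
Proof.
move=> f2 fc; apply/convex_setW => x y; rewrite !inE => fx fy k k0 k1.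
have -> : conv k x y = (y + k%:num *: (x - y) : 'rV[R]_n).
  by rewrite /conv/= scalerBr scalerBl scale1r addrCA addrC addrAC.
(* Equal endpoints are set apart because [strictly_quasiconvex] asks for a nonzero direction. *)
have [->|xy] := eqVneq (x : 'rV[R]_n) y.
  by rewrite inE subrr scaler0 addr0.
rewrite inE; apply/ltW/strictly_quasiconvex => //.
- by rewrite subr_eq0.
- by rewrite addrC subrK.
- by rewrite k0.
Qed.

Lemma compact_level_set (R : realType) (n : nat) (f : 'rV[R]_n -> R)
    (c : R) : continuous f -> norm_coercive f -> compact (level_set f c).
Proof.
move=> fcont fcoer; apply: bounded_closed_compact.
  (* Coercivity gives a weak inequality, so the bound [c + 1] is what excludes the value [c] far
     out. *)
  have [M fM] := fcoer (c + 1); exists M; split; first exact: num_real.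
  move=> K MK x fx; apply/ltW/(le_lt_trans _ MK)/ltW.
  rewrite ltNge; apply/negP => /fM.
  by rewrite fx leNgt ltrDl ltr01.
by move/continuous_closedP: fcont; apply; exact: closed_eq.
Qed.

Unset Implicit Arguments.
Set Strict Implicit.

Theorem theorem3p6 (R : realType) (f : 'rV[R]_2 -> R)
    (f_C2 : smooth 2 f) (f_coercive : norm_coercive f)
    (crit_bounded : bounded_set (critical_set f))
    (nonhess_bounded : bounded_set (~` hess_pos f)) :
  exists c0 : R, forall c : R, c0 < c ->
    [/\ compact (level_set f c), connected (level_set f c),
        regular_level f c & convex_level f c].
Proof.
have fcont := smooth2_continuous f_C2.
(* Boundedness holds for all large radii, so a single positive [r] serves both sets. *)
have [r r0 [/= rcrit rhess]] :=
  pinfty_ex_gt0 (@filterI _ +oo _ _ _ crit_bounded nonhess_bounded).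
pose B : set 'rV[R]_2 := closed_ball_ Num.norm 0 r.
have B0 : B 0 by rewrite /B /closed_ball_/= subr0 normr0 ltW.
have [||p _ fp] := @EVT_max_rV R 2 f B (ex_intro _ 0 B0).
- apply: bounded_closed_compact; last exact: closed_closed_ball_.
  exists r; split=> [|K rK x]; first exact: num_real.
  by rewrite /B /closed_ball_/= sub0r normrN => /le_trans; apply; exact: ltW.
- exact: continuous_subspaceT.
exists (f p) => c pc.
have fB z : `|z| <= r -> f z < c.
  move=> zr; apply: le_lt_trans pc; apply: fp.
  by rewrite inE /B /closed_ball_/= sub0r normrN.
have fc z : c <= f z -> hess_pos f z.
  move=> cz; by apply: contrapT => /rhess/fB; rewrite ltNge cz.
have f0c : f 0 < c by apply: fB; rewrite normr0 ltW.
split.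
- exact: compact_level_set.
- exact: connected_level_set2.
- apply/seteqP; split => // z [fz /rcrit/fB].
  by rewrite fz ltxx.
- exact: convex_level_of_hess_pos.
Qed.
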